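(* Let $C$ be a Kummer cover of degree $n$ over a field $k$ of characteristic $p>0$, presented by $y^n=f=u\prod_{j=1}^{n-1}f_j^j$ with associated integers $m_i$ and polynomials $Q_i$ (all as specified in the context). Then $$a(C)\ \le\ 1-n+\sum_{i=1}^{n-1}\min\{m_i,\ \max\{m_i-q_i+v_i,\ 1+v_i\}\},$$ where $$q_i=\lfloor(\deg(Q_i)+m_{(pi\bmod n)}-1)/p\rfloor\quad\text{and}\quad v_i=\lfloor\deg(Q_i)/p\rfloor.$$
   Context: A Kummer cover of degree $n$ over a field $k$ is an irreducible projective smooth curve $C$ over $k$ for which there exists a finite separable morphism $\psi:C\to\mathbb{P}^1_k$ of degree $n$ such that the function field extension $K(C)/K(\mathbb{P}^1_k)$ is a Kummer extension; this includes that $\operatorname{char}(k)$ does not divide $n$ and that $k$ contains the $n$th roots of unity. Notation: $K(\mathbb{P}^1_k)=k(x)$, and $y$ is a generator of the cyclic extension $K(C)/k(x)$ with $y^n=f=u\prod_{j=1}^{n-1}f_j^j$, where $u\in k^*$, the $f_j\in k[x]$ are separable, the product is the square-free factorization of $f$ (so the $f_j$ are pairwise coprime), and $Z^n-f\in k(x)[Z]$ is irreducible. (Such a presentation exists after an extension of the original base field; $k$ denotes the extended field.) For $0\le i\le n-1$, $m_i=\lceil i\deg(f)/n\rceil-\sum_{j=1}^{n-1}\deg(f_j)\lfloor ji/n\rfloor$. For $1\le i\le n-1$, $$Q_i=f^{\lfloor pi/n\rfloor}\Big/\prod_{j=1}^{n-1}f_j^{\,p\lfloor ji/n\rfloor-\lfloor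 j\cdot(pi\bmod n)/n\rfloor}\in k[x]$$ (the exponents in the denominator may be negative). Here $pi\bmod n$ denotes the representative in $\{0,\dots,n-1\}$. The $a$-number of $C$ is $a(C)=\dim_k\ker(F)$, where $F$ is the map on $H^1(C,\mathcal{O}_C)$ induced by the absolute Frobenius of $C$ (semilinear: $F(\lambda v)=\lambda^pF(v)$).
   Formalization: The curve C is additionally assumed to have k as its full field of constants (geometrically irreducible); without this the bound fails, e.g. for y^2 = t over k = F_3(t), where a(C) = 0 but the bound equals -1. *)

(* Defs.v *)
From HB Require Import structures.
From mathcomp Require Import all_boot all_order all_algebra all_field.
From mathcomp Require Import zify.
Set Implicit Arguments.
Unset Strict Implicit.
Unset Printing Implicit Defensive.
Import Order.TTheory GRing.Theory Num.Theory.
Local Open Scope ring_scope.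

Notation ratfun k := {fraction {poly k}}.

Notation tofrac := (@FracField.tofrac _).

Notation degp p := (size p).-1.

Section CoverCohomology.
Variables (k : fieldType) (K : fieldExtType (ratfun k)).

Definition ratX : ratfun k := tofrac 'X.
Definition const_fun (c : k) : K := (tofrac c%:P)%:A.

(* C is a curve over k: k is the whole field of constants of K.  For a smooth
   curve this says that C is geometrically irreducible.  It does not follow from
   the irreducibility of Z^n - f over k(x) (take f = u constant). *)
Definition constants_trivial : Prop :=
  forall w : K, algebraicOver const_fun w -> exists c : k, w = const_fun c.

(* C is the normalization of the projective line in its function field K, with
   covering map psi.  The three predicates below are the rings of regular
   functions on psi^-1(A^1), on psi^-1(P^1 \ {0}) and on their intersection: the
   integral closures in K of k[x], k[1/x] and k[x,1/x], the last being the image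
   of the two-variable polynomials under (X, Y) |-> (x, 1/x).  *)
Definition regular0 : K -> Prop :=
  integralOver (fun P : {poly k} => (tofrac P)%:A : K).
Definition regularoo : K -> Prop :=
  integralOver (fun P : {poly k} =>
    ((map_poly (tofrac \o polyC) P).[ratX^-1])%:A : K).
Definition regular0oo : K -> Prop :=
  integralOver (fun P : {poly {poly k}} =>
    ((map_poly tofrac P).[ratX^-1])%:A : K).

(* H^1(C, O_C) is Cech cohomology for the affine open cover above: the quotient
   of the space of 1-cocycles regular0oo by that of 1-coboundaries. *)
Definition H1_cobound (w : K) : Prop :=
  exists w0 woo, [/\ regular0 w0, regularoo woo & w = w0 - woo].

(* Representatives of the classes killed by the map F induced on H^1 by w |-> w ^+ p. *)
Definition frob_ker (p : nat) (w : K) : Prop :=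
  regular0oo w /\ H1_cobound (w ^+ p).

(* The quotient V / W has dimension d over k. *)
Definition quot_dim (V W : K -> Prop) (d : nat) : Prop :=
  exists b : 'I_d -> K,
    [/\ forall i, V (b i),
        forall w, V w ->
          exists c : 'I_d -> k, W (w - \sum_(i < d) const_fun (c i) * b i)
      & forall c : 'I_d -> k,
          W (\sum_(i < d) const_fun (c i) * b i) -> forall i, c i = 0].

Definition a_number_is (p d : nat) : Prop := quot_dim (frob_ker p) H1_cobound d.

End CoverCohomology.

Section KummerData.
Variables (k : fieldType) (p n : nat) (u : k) (fj : nat -> {poly k}).

Definition kummer_f : {poly k} := u *: \prod_(1 <= j < n) fj j ^+ j.

(* Only the values fj j with 1 <= j < n are relevant; fj j is constant when no
   root of f has multiplicity j. *)
Record kummer_presentation (K : fieldExtType (ratfun k)) (y : K) : Prop :=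
  KummerPresentation {
    kp_unit : u != 0;
    kp_sep : forall j, (1 <= j < n)%N -> separable_poly (fj j);
    kp_coprime : forall i j, (1 <= i < n)%N -> (1 <= j < n)%N -> i != j ->
      coprimep (fj i) (fj j);
    kp_irr : irreducible_poly
      ('X^n - (tofrac kummer_f)%:P : {poly ratfun k});
    kp_root : y ^+ n = (tofrac kummer_f)%:A;
    kp_gen : <<1; y>>%VS = fullv
  }.

Definition kummer_m (i : nat) : int :=
  Num.ceil ((i * degp kummer_f)%:R / n%:R : rat)
  - \sum_(1 <= j < n) (degp (fj j) * ((j * i) %/ n))%:Z.

Definition kummer_Q_frac (i : nat) : ratfun k :=
  tofrac kummer_f ^+ ((p * i) %/ n) /
  \prod_(1 <= j < n) tofrac (fj j) ^
    ((p * ((j * i) %/ n))%:Z - ((j * ((p * i) %% n)) %/ n)%:Z).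

(* The polynomial equal to the rational function r, when there is one. *)
Definition poly_of_frac (r : ratfun k) : {poly k} :=
  \n_(repr r) %/ \d_(repr r).

Definition kummer_Q (i : nat) : {poly k} := poly_of_frac (kummer_Q_frac i).

Definition kummer_q (i : nat) : int :=
  (((degp (kummer_Q i))%:Z + kummer_m ((p * i) %% n) - 1) %/ p%:Z)%Z.

Definition kummer_v (i : nat) : nat := degp (kummer_Q i) %/ p.

End KummerData.

Lemma poly_of_fracK (k : fieldType) (P : {poly k}) :
  poly_of_frac (tofrac P) = P.
Proof.
rewrite /poly_of_frac; set r := tofrac P.
have : (\pi_(ratfun k) (repr r) = \pi_(ratfun k) (Ratio P 1))%qT.
  by rewrite reprK /r; unlock FracField.tofrac.
move=> /eqmodP/eqP /=; rewrite !numden_Ratio ?oner_eq0 // mulr1 => ->.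
exact: mulKp (denom_ratioP _).
Qed.

Lemma kummer_QE (k : fieldType) (p n : nat) (u : k) (fj : nat -> {poly k}) i :
    (0 < n)%N -> (forall j, (1 <= j < n)%N -> fj j != 0) ->
  tofrac (kummer_Q p n u fj i) = kummer_Q_frac p n u fj i.
Proof.
move=> n_gt0 fj_neq0; rewrite /kummer_Q.
suff [P ->] : exists P, kummer_Q_frac p n u fj i = tofrac P.
  by rewrite poly_of_fracK.
pose e j := ((j * (p * i)) %/ n - p * ((j * i) %/ n))%N.
have eE j : (e j + (p * ((j * i) %/ n)) =
    j * ((p * i) %/ n) + (j * ((p * i) %% n)) %/ n)%N.
  rewrite subnK; last first.
    by rewrite leq_divRL // -mulnA [leqRHS]mulnCA leq_mul2l leq_divM orbT.
  by rewrite {1}(divn_eq (p * i) n) mulnDr mulnA divnMDl.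
exists (u ^+ ((p * i) %/ n) *: \prod_(1 <= j < n) fj j ^+ e j).
rewrite /kummer_Q_frac /kummer_f -!mul_polyC !rmorphM !rmorph_prod /=.
rewrite exprMn -rmorphXn -polyC_exp /= -mulrA; congr (_ * _).
rewrite -prodrXl -prodf_div.
rewrite big_nat_cond [RHS]big_nat_cond; apply: eq_bigr => j.
rewrite andbT => /fj_neq0; rewrite -tofrac_eq0 => fj0.
apply: (canLR (mulfK _)); first by rewrite expfz_neq0.
rewrite !rmorphXn /= -exprM.
have aux (F : fieldType) (x : F) (a b : nat) (z : int) :
    x != 0 -> a%:Z = b%:Z + z -> x ^+ a = x ^+ b * x ^ z.
  by move=> x0 abz; rewrite (exprnP x b) -expfzDr // -abz.
by apply: aux fj0 _; have := eE j; lia.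
Qed.

(* Main.v *)
Require Import Defs.
From HB Require Import structures.
From mathcomp Require Import all_boot all_order all_algebra all_field.
From mathcomp Require Import zify ring.
From Stdlib Require Import Classical_Prop.
Set Implicit Arguments.
Unset Strict Implicit.
Unset Printing Implicit Defensive.
Import Order.TTheory GRing.Theory Num.Theory.
Local Open Scope ring_scope.

(** Let z_i = y^i / D_i, where D_i is the product of the f_j^floor(ji/n). Then
    z_i^n is the polynomial E_i = u^i prod_j f_j^(ji mod n), no n-th power of a
    nonconstant polynomial divides E_i, and n (m_i - 1) < deg E_i <= n m_i. The
    z_i with 0 <= i < n form a basis of K over k(x) and are eigenvectors, with
    distinct characters, of the group of n-th roots of unity acting by
    y |-> zeta y. Averaging over this group shows that a sum of c_i z_i is
    integral over a subring of k(x) containing k only if each c_i^n E_i is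
    (integral_coef). As E_i is n-power-free, this forces c_i into k[x] or
    k[x,1/x] on the charts where x has no pole (regular0_coef,
    regular0oo_coef), and into functions vanishing to order at least m_i at
    infinity on the other chart (regularoo_coef).

    Consequently H^1 is the direct sum over i of the Laurent polynomials modulo
    those with all exponents >= 0 and those with all exponents <= - m_i, and it
    has the basis x^-a z_i with 1 <= a < m_i (cocycle_span, cocycle_free). For
    i > 0 one has m_i >= 1, since otherwise z_i would be a nonconstant function
    algebraic over k (kummer_m_gt0); so the i-th summand has dimension m_i - 1.

    Frobenius sends z_i to Q_i z_(pi mod n) (kummer_elt_frob), hence the i-th
    summand to the (pi mod n)-th one, and i |-> pi mod n is injective. The image
    of x^-a z_i has the coefficient Q_i x^(-pa), of degree deg Q_i - pa. When
    deg Q_i < pa < deg Q_i + m_(pi mod n), that is v_i < a <= q_i, this degree is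
    the exponent of a basis element of the target. These degrees are distinct
    for distinct a, so Frobenius is injective on the span of the classes with
    v_i < a <= q_i (principal_part_eq0, frob_injective). The dimension of its
    kernel is therefore at most the number of the remaining pairs (i, a)
    (quot_dim_le), and counting these gives the bound. *)

(** * Integral elements of k(x) *)

Lemma expr_sub_inv (F : fieldType) (z : F) l d :
  z != 0 -> (l <= d)%N -> z ^+ l = z ^+ d * z^-1 ^+ (d - l).
Proof.
move=> z0 le_ld; rewrite -[in RHS](subnK le_ld) addnC exprD -mulrA exprVn addnC.
by rewrite subnK // mulfV ?mulr1 // expf_neq0.
Qed.

Section RationalFunctions.
Variable k : fieldType.
Implicit Types (r s : ratfun k) (A B P : {poly k}).

(** This lemma and the next two restate known facts at the type {poly k}. The
    general versions produce sizes that are convertible but syntactically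
    different, which linear arithmetic would treat as unrelated unknowns. *)
Lemma poly_neq0_size A : (A != 0) = (0 < size A)%N.
Proof. by rewrite size_poly_gt0. Qed.

Lemma size_poly_mul_leq A B : (size (A * B)%R <= (size A + size B).-1)%N.
Proof. exact: size_polyMleq. Qed.

Lemma size_poly_mul A B : A != 0 -> B != 0 ->
  size (A * B) = (size A + size B).-1.
Proof. exact: size_mul. Qed.

Lemma ratfun_coprime r :
  exists A B, [/\ B != 0, coprimep A B & r = tofrac A / tofrac B].
Proof.
have [A [B [B0 ->]]] : exists A B, B != 0 /\ r = tofrac A / tofrac B.
  exists \n_(repr r), \d_(repr r); have d0 := denom_ratioP (repr r).
  split=> //; apply: (canRL (mulfK _)); first by rewrite tofrac_eq0.
  rewrite -[X in X * _]reprK; unlock FracField.tofrac.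
  set t := repr r in d0 *.
  rewrite /GRing.mul /= -FracField.pi_mul /FracField.mulf.
  apply/eqmodP => /=; rewrite FracField.equivfE !numden_Ratio ?mulr1 ?oner_eq0 //.
  by rewrite mulrC.
set g := gcdp A B; have g0 : g != 0 by rewrite gcdp_eq0 (negPf B0) andbF.
have gA := divpK (dvdp_gcdl A B); have gB := divpK (dvdp_gcdr A B).
exists (A %/ g), (B %/ g); split.
- by apply: contraNneq B0 => e; rewrite -gB e mul0r.
- by rewrite coprimep_div_gcd // B0 orbT.
rewrite -[X in tofrac X / _]gA -[X in _ / tofrac X]gB -/g !tofracM.
rewrite -mulf_div divff ?mulr1 //.
by rewrite tofrac_eq0.
Qed.

Lemma integral_relation (R : comNzRingType) (F : fieldType)
    (phi : {rmorphism R -> F}) (z : F) : integralOver phi z ->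
  exists (d : nat) (c : nat -> R), z ^+ d = \sum_(l < d) phi (c l) * z ^+ l.
Proof.
case=> p mon_p; rewrite /root /map_poly horner_poly.
rewrite [size p]polySpred ?monic_neq0 // big_ord_recr /=.
have -> : p`_(size p).-1 = 1 by rewrite -(monicP mon_p).
rewrite rmorph1 mul1r addrC addr_eq0 -sumrN => /eqP zE.
exists (size p).-1, (fun l => - p`_l).
by rewrite zE; apply: eq_bigr => l _; rewrite rmorphN mulNr.
Qed.

(** The rational root argument, relative to a fixed denominator h. If r = A / D
    in lowest terms satisfies a monic equation of degree d, then clearing the
    powers of h in the coefficients makes D divide A ^ d h ^ N, hence h ^ N.
    With h = 1 this says that k[x] is integrally closed, with h = x that
    k[x,1/x] is. *)
Lemma integral_denominator (R : comNzRingType)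
    (phi : {rmorphism R -> ratfun k}) h r :
    (forall b, exists N P, phi b * tofrac h ^+ N = tofrac P) ->
  integralOver phi r -> exists N P, r * tofrac h ^+ N = tofrac P.
Proof.
move=> Hphi /integral_relation[d [c rE]].
have [A [D [D0 copAD def_r]]] := ratfun_coprime r.
have tD0 : tofrac D != 0 by rewrite tofrac_eq0.
have HN m : exists N, forall l, (l < m)%N ->
    exists P, phi (c l) * tofrac h ^+ N = tofrac P.
  elim: m => [|m [N IH]]; first by exists 0%N.
  have [M [P PE]] := Hphi (c m); exists (N + M)%N => l.
  rewrite ltnS leq_eqVlt => /orP[/eqP-> | /IH[S SE]].
    by exists (P * h ^+ N); rewrite rmorphM rmorphXn /= -PE addnC exprD mulrA.
  by exists (S * h ^+ M); rewrite rmorphM rmorphXn /= -SE exprD mulrA.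
have {HN}[N HN] := HN d.
have DdvdA : D %| A ^+ d * h ^+ N.
  have [Q QE] : exists Q, tofrac (A ^+ d * h ^+ N) = tofrac (D * Q).
    rewrite rmorphM !rmorphXn /=.
    have AE : tofrac A = r * tofrac D by rewrite def_r divfK.
    rewrite AE exprMn rE mulr_suml mulr_suml.
    elim/big_ind: _ => [|x y [Q1 ->] [Q2 ->]|[l lt_ld] _ /=].
    - by exists 0; rewrite mulr0 tofrac0.
    - by exists (Q1 + Q2); rewrite mulrDr rmorphD.
    have [P PE] := HN _ lt_ld.
    exists (P * A ^+ l * D ^+ (d - l.+1)).
    rewrite !rmorphM !rmorphXn /= -PE AE exprMn.
    by rewrite -[in LHS](subnKC lt_ld) addSn exprS exprD; ring.
  by have /eqP := QE; rewrite tofrac_eq => /eqP->; apply: dvdp_mulr.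
have: D %| h ^+ N.
  have copDA : coprimep D (A ^+ d) by rewrite coprimep_expr // coprimep_sym.
  by rewrite -(Gauss_dvdpr _ copDA).
case/dvdpP => Q hE; exists N, (A * Q).
by rewrite def_r -rmorphXn /= hE !tofracM mulrA mulrAC divfK.
Qed.

(** The valuation ring of the place at infinity: the degree of the numerator is
    at most the degree of the denominator. *)
Definition pole_free_oo r : Prop :=
  exists A B, [/\ B != 0, r = tofrac A / tofrac B & (size A <= size B)%N].

Lemma pole_free_ooE A B : B != 0 ->
  pole_free_oo (tofrac A / tofrac B) <-> (size A <= size B)%N.
Proof.
move=> B0; split; last by move=> le_AB; exists A, B.
case=> A' [B' [B'0 /eqP]].
rewrite eqr_div ?tofrac_eq0 // -!tofracM tofrac_eq => /eqP e le_AB.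
have [-> | A0] := eqVneq A 0; first by rewrite size_poly0.
have A'0 : A' != 0.
  by apply: contraNneq (mulf_neq0 A0 B'0) => A'0; rewrite e A'0 mul0r.
have /(congr1 (fun P : {poly k} => size P)) := e.
rewrite !size_poly_mul //; move: A0 B0 B'0 A'0; rewrite !poly_neq0_size; lia.
Qed.

Lemma pole_free_ooD r s :
  pole_free_oo r -> pole_free_oo s -> pole_free_oo (r + s).
Proof.
move=> [A [B [B0 -> le_AB]]] [C [D [D0 -> le_CD]]].
rewrite addf_div ?tofrac_eq0 // -!tofracM -tofracD.
apply/pole_free_ooE; rewrite ?mulf_neq0 // (leq_trans (size_polyD _ _)) //.
rewrite (size_poly_mul B0 D0) geq_max.
by apply/andP; split; apply: (leq_trans (size_poly_mul_leq _ _)); lia.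
Qed.

Lemma pole_free_ooM r s :
  pole_free_oo r -> pole_free_oo s -> pole_free_oo (r * s).
Proof.
move=> [A [B [B0 -> le_AB]]] [C [D [D0 -> le_CD]]].
rewrite mulf_div -!tofracM.
apply/pole_free_ooE; rewrite ?mulf_neq0 //.
rewrite (size_poly_mul B0 D0).
by apply: (leq_trans (size_poly_mul_leq _ _)); lia.
Qed.

Lemma pole_free_oo_const (c : k) : pole_free_oo (tofrac c%:P).
Proof.
rewrite -[tofrac _]divr1 -tofrac1; apply/pole_free_ooE; rewrite ?oner_eq0 //.
by rewrite size_poly1 size_polyC leq_b1.
Qed.

Lemma pole_free_ooX r m : pole_free_oo r -> pole_free_oo (r ^+ m).
Proof.
move=> Vr; elim: m => [|m IH]; last by rewrite exprS; apply: pole_free_ooM.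
by rewrite expr0 -tofrac1; apply: pole_free_oo_const.
Qed.

Lemma pole_free_oo_sum (I : Type) (e : seq I) (Pr : pred I)
    (F : I -> ratfun k) :
  (forall i, Pr i -> pole_free_oo (F i)) ->
  pole_free_oo (\sum_(i <- e | Pr i) F i).
Proof.
move=> VF; elim/big_ind: _ => //; last exact: pole_free_ooD.
by rewrite -tofrac0 -[0]polyC0; apply: pole_free_oo_const.
Qed.

(** A valuation ring is integrally closed: either r or 1 / r lies in it, and in
    the second case dividing the equation r ^ (d + 1) = ... by r ^ d writes r as
    a polynomial in 1 / r. *)
Lemma integral_pole_free_oo (R : comNzRingType)
    (phi : {rmorphism R -> ratfun k}) r :
  (forall b, pole_free_oo (phi b)) -> integralOver phi r -> pole_free_oo r.
Proof.
move=> Hphi /integral_relation[d [c rE]].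
have [A [B [B0 copAB def_r]]] := ratfun_coprime r.
have [le_AB | lt_BA] := leqP (size A) (size B); first by exists A, B.
have A0 : A != 0 by rewrite -size_poly_gt0; apply: leq_ltn_trans lt_BA.
have r0 : r != 0 by rewrite def_r mulf_neq0 ?invr_eq0 ?tofrac_eq0.
have Vr' : pole_free_oo r^-1.
  have -> : r^-1 = tofrac B / tofrac A by rewrite def_r invf_div.
  by apply/(pole_free_ooE _ A0)/ltnW.
case: d rE => [|d] rE.
  by move: rE; rewrite big_ord0 expr0 => /eqP; rewrite oner_eq0.
have -> : r = \sum_(l < d.+1) phi (c l) * r^-1 ^+ (d - l).
  apply: (mulfI (expf_neq0 d r0)); rewrite -exprSr rE mulr_sumr.
  apply: eq_bigr => l _; rewrite mulrCA; congr (_ * _).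
  exact: expr_sub_inv r0 (leq_ord l).
by apply: pole_free_oo_sum => l _; apply/pole_free_ooM/pole_free_ooX.
Qed.

End RationalFunctions.

(** * Coefficients constrained by a power-free radicand *)

Section PowerFree.
Variable k : fieldType.
Implicit Types (A B P : {poly k}).

Lemma coprimep_prod_seq (t : {poly k}) (s : seq nat) (Pr : pred nat)
    (F : nat -> {poly k}) :
  (forall j, j \in s -> Pr j -> coprimep t (F j)) ->
  coprimep t (\prod_(j <- s | Pr j) F j).
Proof.
move=> cop; rewrite big_seq_cond; elim/big_ind: _ => [|x y|j /andP[]].
- exact: coprimep1.
- by rewrite coprimepMr => -> ->.
- exact: cop.
Qed.

(** The polynomials f_j are square-free and pairwise coprime, so a common factor g
    of t and f_j is prime to f_j / g and to the other f_i. Then g ^ n must divide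
    g ^ (e_j), and e_j < n makes g constant. *)
Lemma prod_power_free n (f : nat -> {poly k}) (e : nat -> nat) (t : {poly k})
    (s : seq nat) : (0 < n)%N ->
    (forall j, j \in s -> (e j < n)%N) ->
    (forall j, j \in s -> separable_poly (f j)) -> uniq s ->
    (forall i j, i \in s -> j \in s -> i != j -> coprimep (f i) (f j)) ->
  t ^+ n %| \prod_(j <- s) f j ^+ e j -> size t = 1%N.
Proof.
move=> n_gt0 lt_en sep_f uniq_s cop_f dvd_t.
have aux (a b c m l : nat) : (0 < a -> 0 < b -> 0 < c -> b.-1 = a.-1 * m ->
  c.-1 = a.-1 * l -> l < m -> b <= c -> a == 1)%N by nia.
have cop_t j : j \in s -> coprimep t (f j).
  move=> js; set g := gcdp t (f j).
  have g0 : g != 0.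
    by rewrite gcdp_eq0 negb_and (separable_poly_neq0 (sep_f j js)) orbT.
  have fE := divpK (dvdp_gcdr t (f j)); rewrite -/g in fE.
  have cop_gh : coprimep g (f j %/ g).
    by rewrite coprimep_sym (separable_coprime (sep_f j js)) // fE.
  have : g ^+ n %| \prod_(i <- s) f i ^+ e i.
    by rewrite (dvdp_trans _ dvd_t) // dvdp_exp2r // dvdp_gcdl.
  rewrite (bigD1_seq j) //= Gauss_dvdpl; last first.
    apply/coprimep_expl/coprimep_prod_seq => i i_s ij.
    by apply/coprimep_expr/(coprimep_dvdr (dvdp_gcdr t _)); rewrite coprimep_sym cop_f.
  have -> : f j ^+ e j = (f j %/ g) ^+ e j * g ^+ e j by rewrite -exprMn fE.
  rewrite Gauss_dvdpr; last exact/coprimep_expl/coprimep_expr.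
  move/dvdp_leq; rewrite expf_neq0 // => /(_ isT).
  move: (size_exp g n) (size_exp g (e j)) (lt_en j js).
  rewrite /coprimep -/g; move: g0 (expf_neq0 n g0) (expf_neq0 (e j) g0).
  rewrite !poly_neq0_size; exact: aux.
have: coprimep (t ^+ n) (t ^+ n).
  rewrite (coprimep_dvdl dvd_t) // ; apply/coprimep_expl/coprimep_prod_seq.
  by move=> j js _; apply/coprimep_expr/cop_t.
rewrite coprimepp => /eqP tn1.
have := size_exp t n; rewrite tn1.
have : t != 0.
  by apply/eqP => t0; move: tn1; rewrite t0 expr0n gtn_eqF // size_poly0.
have aux1 (a m : nat) : (0 < m -> 0 < a -> 0 = a.-1 * m -> a = 1)%N by nia.
by rewrite poly_neq0_size; apply: aux1.
Qed.

Lemma expr_clear_denominator (F : fieldType) (c e h d : F) N n : (0 < n)%N ->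
  (c * h ^+ N * d) ^+ n * e = c ^+ n * e * h ^+ N * h ^+ (N * n.-1) * d ^+ n.
Proof.
case: n => // n _; rewrite !exprMn -exprM mulnS exprD /=.
by rewrite -!mulrA; congr (_ * _); rewrite [RHS]mulrC !mulrA mulrAC.
Qed.

(** If c h ^ N has reduced denominator D, then D ^ n divides the power-free E,
    and D is constant. *)
Lemma power_free_denominator n (E h : {poly k}) (c : ratfun k) N P :
    (0 < n)%N -> E != 0 -> (forall t, t ^+ n %| E -> size t = 1%N) ->
    c ^+ n * tofrac E * tofrac h ^+ N = tofrac P ->
  exists P', c * tofrac h ^+ N = tofrac P'.
Proof.
move=> n_gt0 E0 pfE; have [A [D [D0 cop]]] := ratfun_coprime (c * tofrac h ^+ N).
have tD0 : tofrac D != 0 by rewrite tofrac_eq0.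
move=> bE PE; have {PE} : A ^+ n * E = P * h ^+ (N * n.-1) * D ^+ n.
  apply/eqP; rewrite -tofrac_eq !rmorphM !rmorphXn /= -PE.
  have -> : tofrac A = c * tofrac h ^+ N * tofrac D by rewrite bE divfK.
  exact/eqP/expr_clear_denominator.
move=> PE; have : size D = 1%N.
  apply: pfE; have copDA : coprimep (D ^+ n) (A ^+ n).
    by rewrite coprimep_expl // coprimep_expr // coprimep_sym.
  by rewrite -(Gauss_dvdpr _ copDA) PE dvdp_mull.
move/eqP/size_poly1P => [d d0 DE]; exists (d^-1 *: A).
rewrite bE DE -mul_polyC tofracM mulrC; congr (_ * _).
rewrite DE in tD0; apply: (mulIf tD0).
by rewrite (mulVf tD0) -tofracM -polyCM (mulVf d0) tofrac1.
Qed.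

(** In degrees: n deg c <= - deg E < n (1 - m), and deg c is an integer. *)
Lemma pole_free_oo_root n m (E : {poly k}) (c : ratfun k) :
    (0 < n)%N -> E != 0 -> (n * m < degp E + n)%N ->
    pole_free_oo (c ^+ n * tofrac E) -> pole_free_oo (c * tofrac 'X^m).
Proof.
move=> n_gt0 E0 lt_m; have [A [D [D0 _ ->]]] := ratfun_coprime c.
rewrite expr_div_n -!tofracXn mulrAC -tofracM pole_free_ooE ?expf_neq0 //.
rewrite mulrAC -tofracM pole_free_ooE //.
have [-> | A0] := eqVneq A 0; first by rewrite mul0r size_poly0.
have aux (a d e a' d' : nat) : (a'.-1 = a.-1 * n -> d'.-1 = d.-1 * n ->
    0 < a' -> 0 < d' -> 0 < a -> 0 < d -> 0 < e -> n * m < e.-1 + n ->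
    (a' + e).-1 <= d' -> (a + m.+1).-1 <= d)%N by nia.
rewrite !size_poly_mul ?expf_neq0 ?polyX_eq0 // size_polyXn.
by apply: aux lt_m; rewrite ?size_exp // -poly_neq0_size ?expf_neq0.
Qed.

(** The leading term argument on which both the independence of the cohomology
    classes and the injectivity of Frobenius rest. The product of Q with a
    nonzero combination of the x ^ (- s (a + 1)) has degree
    deg Q - s (a + 1) for the smallest a involved, which the window hypothesis
    places strictly between - m and 0. The sum of a polynomial and of a function
    of degree at most - m never has such a degree. *)
Lemma principal_part_eq0 (Q P : {poly k}) (R : ratfun k) s m mu
    (l : 'I_mu -> k) :
    Q != 0 -> (0 < s)%N -> pole_free_oo (R * tofrac 'X^m) ->
    (forall a : 'I_mu, l a != 0 -> (degp Q < s * a.+1 < degp Q + m)%N) ->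
    tofrac Q * \sum_a tofrac (l a)%:P * (tofrac 'X)^-1 ^+ (s * a.+1)
      = tofrac P + R ->
  forall a, l a = 0.
Proof.
move=> Q0 s_gt0 VR wl eqQ.
(* The sum times x ^ (s mu), the least power that clears all its terms. *)
pose H : {poly k} := \sum_(a < mu) l a *: 'X^(s * (mu - a.+1)).
have X0 : tofrac 'X != 0 :> ratfun k by rewrite tofrac_eq0 polyX_eq0.
have eqH : \sum_a tofrac (l a)%:P * (tofrac 'X)^-1 ^+ (s * a.+1)
    = tofrac H / tofrac 'X^(s * mu).
  apply: (canRL (mulfK _)); first by rewrite tofracXn expf_neq0.
  rewrite mulr_suml rmorph_sum; apply: eq_bigr => a _ /=.
  rewrite -mul_polyC tofracM -mulrA; congr (_ * _).
  rewrite !tofracXn exprVn; apply: (canLR (mulKf _)).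
    by rewrite expf_neq0.
  by rewrite -exprD -mulnDr subnKC.
have [H0 | H0] := eqVneq H 0.
  move=> a; have /(congr1 (fun p : {poly k} => p`_(s * (mu - a.+1)))) := H0.
  rewrite coef_sum coef0 (bigD1 a) //= coefZ coefXn eqxx mulr1.
  rewrite big1 ?addr0 // => b ba; rewrite coefZ coefXn.
  rewrite eqn_pmul2l // eqn_sub2lE // eqSS (inj_eq (@ord_inj mu)) eq_sym.
  by rewrite (negPf ba) mulr0.
have [a la0 degH] : exists2 a : 'I_mu, l a != 0 &
    degp H = (s * (mu - a.+1))%N.
  have: H`_(degp H) != 0 by rewrite -lead_coefE lead_coef_eq0.
  rewrite coef_sum => /eqP nz.
  case: (pickP (fun a : 'I_mu => (l a != 0) && (degp H == s * (mu - a.+1))%N)).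
    by move=> a /andP[la0 /eqP e]; exists a.
  move=> none; case: nz; apply: big1 => a _; rewrite coefZ coefXn.
  by have := none a; case: eqVneq => [->|_ /= ->]; rewrite ?mul0r ?mulr0.
have {eqQ}eqR : R = tofrac (Q * H - P * 'X^(s * mu)) / tofrac 'X^(s * mu).
  rewrite rmorphB !rmorphM /= mulrBl mulfK; last by rewrite tofracXn expf_neq0.
  by rewrite -mulrA -eqH eqQ addrAC subrr add0r.
move: VR; rewrite eqR mulrAC -tofracM pole_free_ooE; last first.
  by rewrite expf_neq0 ?polyX_eq0.
have /andP[ltQ ltm] := wl a la0.
have a_mu : (s * (mu - a.+1) + s * a.+1 = s * mu)%N.
  by rewrite -mulnDr subnK.
have sG : size (Q * H) = (degp Q + degp H).+1.
  by rewrite size_poly_mul //; move: Q0 H0; rewrite !poly_neq0_size; lia.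
(* If P <> 0 then P x ^ (s mu) dominates Q H, which has degree below s mu. *)
set S := Q * H - _; have S0 : S != 0 /\ ((s * mu).+1 < size S + m)%N.
  rewrite /S; have [-> | P0] := eqVneq P 0.
    rewrite mul0r subr0 mulf_neq0 // sG; split=> //; lia.
  have sP : size (P * 'X^(s * mu)) = (size P + s * mu)%N.
    by rewrite size_poly_mul ?expf_neq0 ?polyX_eq0 // size_polyXn addnS.
  have sS : size (Q * H - P * 'X^(s * mu)) = (size P + s * mu)%N.
    rewrite addrC size_polyDl size_polyN // sP sG.
    move: P0; rewrite poly_neq0_size; lia.
  rewrite poly_neq0_size sS; move: P0; rewrite -size_poly_gt0; lia.
case: S0 => S0 ltS; rewrite size_poly_mul ?expf_neq0 ?polyX_eq0 // !size_polyXn.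
by rewrite addnS /= leqNgt ltS.
Qed.

End PowerFree.

(** * Dimension of a quotient with a known set of coordinates *)

Section LinearAlgebra.
Variable k : fieldType.

(** Membership in S need not be decidable, so a matrix of maximal rank inside S
    is obtained by excluded middle, adding one row at a time. *)
Lemma subspace_row_space N (S : 'rV[k]_N -> Prop) :
    S 0 -> (forall c v w, S v -> S w -> S (c *: v + w)) ->
  exists A : 'M[k]_N, forall v, S v <-> (v <= A)%MS.
Proof.
move=> S0 Slin.
have [A [SA maxA]] : exists A : 'M[k]_N, (forall v, (v <= A)%MS -> S v) /\
    forall v, S v -> (v <= A)%MS.
  have: forall m (A : 'M[k]_N), (forall v, (v <= A)%MS -> S v) ->
      (N - \rank A <= m)%N ->
    exists A : 'M[k]_N, (forall v, (v <= A)%MS -> S v) /\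
      forall v, S v -> (v <= A)%MS.
    elim=> [|m IH] A SA le_m.
      exists A; split=> // v _; apply: submx_full; rewrite /row_full eqn_leq.
      by rewrite rank_leq_row -subn_eq0 -leqn0.
    have [[v [Sv nAv]] | maxA] := classic (exists v, S v /\ ~~ (v <= A)%MS); last first.
      exists A; split=> // v Sv; apply: contraT => nAv.
      by case: maxA; exists v.
    apply: (IH (A + v)%MS) => [w /sub_addsmxP[[a b] /= ->]|].
      rewrite addrC [b]mx11_scalar mul_scalar_mx; apply: Slin => //.
      exact/SA/submxMl.
    have : (A < A + v)%MS.
      by rewrite /ltmx addsmxSl addsmx_sub submx_refl.
    rewrite ltmxErank addsmxSl /=; lia.
  move/(_ N (0 : 'M[k]_N)); apply; last exact: leq_subr.
  by move=> v; rewrite submx0 => /eqP->.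
by exists A => v; split; [apply: maxA | apply: SA].
Qed.

Variables (K : fieldExtType (ratfun k)).

(** The classes of the e i form a basis of a space in which V / W is a subspace;
    the e i themselves need not lie in V. If an element of V / W is determined by
    its coordinates in J, then projecting to these coordinates is injective, and
    dim V / W is at most the size of J. Applied with V the kernel of the
    semilinear Frobenius map, this avoids any statement on its image, which need
    not be a k-subspace when k is not perfect. *)
Lemma quot_dim_le (V W : K -> Prop) (I : finType) (e : I -> K) (J : {pred I}) :
    V 0 -> (forall c v w, V v -> V w -> V (const_fun K c * v + w)) ->
    (forall w, W w -> V w) ->
    (forall v w, W v -> W w -> W (v + w)) ->
    (forall w, V w -> exists c : I -> k, W (w - \sum_i const_fun K (c i) * e i)) ->
    (forall c : I -> k, W (\sum_i const_fun K (c i) * e i) -> forall i, c i = 0) ->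
    (forall c : I -> k, V (\sum_i const_fun K (c i) * e i) ->
       {in J, forall i, c i = 0} -> forall i, c i = 0) ->
  exists2 d, quot_dim V W d & (d <= #|J|)%N.
Proof.
move=> V0 Vlin WV WD span free hJ.
pose T (v : 'rV[k]_#|I|) := \sum_i const_fun K (v 0 (enum_rank i)) * e i.
have TE (c : I -> k) : T (\row_j c (enum_val j)) = \sum_i const_fun K (c i) * e i.
  by apply: eq_bigr => i _; rewrite mxE enum_rankK.
have cD a b : const_fun K (a + b) = const_fun K a + const_fun K b.
  by rewrite /const_fun polyCD tofracD scalerDl.
have cM a b : const_fun K (a * b) = const_fun K a * const_fun K b.
  by rewrite /const_fun polyCM tofracM -scalerAl mul1r scalerA.
have c0 : const_fun K 0 = 0 by rewrite /const_fun polyC0 tofrac0 scale0r.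
have Tlin c v w : T (c *: v + w) = const_fun K c * T v + T w.
  rewrite /T mulr_sumr -big_split; apply: eq_bigr => i _ /=.
  by rewrite !mxE cD cM mulrDl mulrA.
have T0 : T 0 = 0 by rewrite /T big1 // => i _; rewrite mxE c0 mul0r.
have TS (J' : finType) (c : J' -> k) (F : J' -> 'rV_#|I|) :
    T (\sum_j c j *: F j) = \sum_j const_fun K (c j) * T (F j).
  elim/big_rec2: _ => // j y1 y2 _ <-; exact: Tlin.
have [A AE] : exists A : 'M[k]_#|I|, forall v, V (T v) <-> (v <= A)%MS.
  apply: subspace_row_space => [|c v w Vv Vw]; first by rewrite T0.
  by rewrite Tlin; apply: Vlin.
pose B := row_base A; exists (\rank A).
  exists (fun i => T (row i B)); split=> [i | w Vw | c Wc i].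
  - by apply/AE; rewrite (submx_trans (row_sub _ _)) // eq_row_base.
  - have [c Wc] := span w Vw; rewrite -TE in Wc; set v := \row_j _ in Wc.
    have /AE : V (T v).
      have -> : T v = const_fun K (-1) * (w - T v) + w.
        by rewrite /const_fun polyCN tofracN scaleN1r mulN1r opprB subrK.
      exact/Vlin/Vw/WV.
    rewrite -(eq_row_base A) => /submxP[D vE]; exists (fun i => D 0 i).
    rewrite -TS -mulmx_sum_row -vE //.
  - move: Wc; rewrite -TS -[X in T X]/(\sum_j c j *: row j B).
    set D := \row_j c j.
    have -> : \sum_j c j *: row j B = D *m B.
      by rewrite mulmx_sum_row; apply: eq_bigr => j _; rewrite mxE.
    rewrite -[D *m B]/(_) => WT.
    have : D *m B = 0.
      apply/rowP => j; rewrite [RHS]mxE -[j]enum_valK.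
      by apply: (free (fun i => (D *m B) 0 (enum_rank i))).
    move/eqP; rewrite mulmx_free_eq0 ?row_base_free // => /eqP/rowP/(_ i).
    by rewrite !mxE.
pose f (j : 'I_#|J|) := enum_rank (enum_val j : I).
suff : row_free (colsub f B).
  by rewrite /row_free => /eqP <-; apply: rank_leq_col.
apply/inj_row_free => D D0.
suff : D *m B = 0.
  by move/eqP; rewrite mulmx_free_eq0 ?row_base_free // => /eqP.
have VD : V (T (D *m B)).
  by apply/AE; rewrite -(eq_row_base A) submxMl.
apply/rowP => j; rewrite [RHS]mxE -[j]enum_valK.
apply: (hJ (fun i => (D *m B) 0 (enum_rank i))) => // i iJ.
have := congr1 (fun M : 'rV_#|J| => M 0 (enum_rank_in iJ i)) D0.
rewrite mulmx_colsub [LHS]mxE [RHS]mxE /f. by rewrite (enum_rankK_in iJ iJ).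
Qed.

End LinearAlgebra.

(** * Power bases and conjugations of a simple extension *)

Section PrimitiveElement.
Variables (F : fieldType) (L : fieldExtType F) (q : {poly F}) (y : L).
Hypothesis irr_q : irreducible_poly q.
Hypothesis qy0 : root (map_poly (in_alg L) q) y.
Hypothesis gen_y : <<1; y>>%VS = fullv.

(** The minimal polynomial has coefficients in F and divides the irreducible q. *)
Lemma minPoly_eqp : minPoly 1 y %= map_poly (in_alg L) q.
Proof.
have /polyOver1P[m mE] := minPolyOver 1 y.
have : minPoly 1 y %| map_poly (in_alg L) q.
  by apply: minPoly_dvdp => //; apply: alg_polyOver.
rewrite mE dvdp_map eqp_map; apply: irr_q.2.
rewrite -(size_map_poly (in_alg L)) -mE size_minPoly eqSS.
by rewrite -lt0n.
Qed.

Lemma adjoin_degreeE : adjoin_degree 1 y = degp q.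
Proof.
have := eqp_size minPoly_eqp; rewrite size_minPoly size_map_poly => <-.
by [].
Qed.

Lemma gen_free m (dq : degp q = m) (c : 'I_m -> F) :
  \sum_i c i *: y ^+ i = 0 -> forall i, c i = 0.
Proof.
case: _ / dq c => c c0 i.
pose P := \poly_(j < degp q) (if insub j is Some i then c i else 0).
have : root (map_poly (in_alg L) P) y.
  rewrite /root (horner_coef_wide _ (n := degp q)); last first.
    by rewrite size_map_poly size_poly.
  rewrite -[X in _ == X]c0; apply/eqP/eq_bigr => j _.
  by rewrite coef_map coef_poly ltn_ord valK mulr_algl.
rewrite (root_small_adjoin_poly (K := 1%AS)) ?alg_polyOver //; last first.
  by rewrite size_map_poly adjoin_degreeE size_poly.
rewrite map_poly_eq0 => /eqP/(congr1 (fun R : {poly F} => R`_i)).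
by rewrite coef0 coef_poly ltn_ord valK.
Qed.

Lemma gen_span m (dq : degp q = m) (w : L) :
  exists c : 'I_m -> F, w = \sum_i c i *: y ^+ i.
Proof.
case: _ / dq.
have wy : w \in <<1; y>>%VS by rewrite gen_y memvf.
have /polyOver1P[P PE] := Fadjoin_polyOver 1 y w.
exists (fun i => P`_i); rewrite -[LHS](Fadjoin_poly_eq wy).
rewrite (horner_coef_wide _ (n := degp q)) -?adjoin_degreeE ?size_Fadjoin_poly //.
by apply: eq_bigr => i _; rewrite PE coef_map mulr_algl.
Qed.

Lemma conjugation (y' : L) : root (map_poly (in_alg L) q) y' ->
  exists s : {rmorphism L -> L}, s y = y' /\ forall c w, s (c *: w) = c *: s w.
Proof.
move=> qy'; have f1 := kHom1 (1%AS : {subfield L}) 1%AS.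
have r' : root (map_poly (\1%VF : 'End(L)) (minPoly 1 y)) y'.
  by rewrite lfun1_poly (eqp_root minPoly_eqp).
have := kHomExtendP (subvv _) f1 r'; have sy := kHomExtend_val f1 r'.
move: sy; set s := kHomExtend _ _ _ _ => sy; rewrite gen_y => /kHom_monoid_morphism sM.
pose M := GRing.isMonoidMorphism.Build L L s sM.
pose Sp : {rmorphism L -> L} := HB.pack (fun x => s x) M
  (GRing.isZmodMorphism.Build L L s (raddfB s)).
by exists Sp; split=> [|c w]; rewrite /= ?linearZ.
Qed.

End PrimitiveElement.

(** * The normalized powers of the Kummer generator: degrees *)

Section KummerArithmetic.
Variables (k : fieldType) (n : nat) (u : k) (fj : nat -> {poly k}).
Hypothesis n_gt0 : (0 < n)%N.
Hypothesis u0 : u != 0.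
Hypothesis sep_fj : forall j, (1 <= j < n)%N -> separable_poly (fj j).
Hypothesis cop_fj : forall i j, (1 <= i < n)%N -> (1 <= j < n)%N -> i != j ->
  coprimep (fj i) (fj j).

(** The largest polynomial D such that y ^ i / D is integral over k[x]. *)
Definition kummer_den (i : nat) : {poly k} :=
  \prod_(1 <= j < n) fj j ^+ ((j * i) %/ n).

(** The n-th power of y ^ i / kummer_den i. *)
Definition kummer_rad (i : nat) : {poly k} :=
  u ^+ i *: \prod_(1 <= j < n) fj j ^+ ((j * i) %% n).

Let fj_neq0 j : (1 <= j < n)%N -> fj j != 0.
Proof. by move/sep_fj/separable_poly_neq0. Qed.

Lemma prod_fj_neq0 (e : nat -> nat) : \prod_(1 <= j < n) fj j ^+ e j != 0.
Proof.
rewrite prodf_seq_neq0; apply/allP => j; rewrite mem_index_iota => /fj_neq0 f0.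
by rewrite /= expf_neq0.
Qed.

Lemma kummer_den_neq0 i : kummer_den i != 0.
Proof. exact: prod_fj_neq0. Qed.

Lemma kummer_rad_neq0 i : kummer_rad i != 0.
Proof. by rewrite scaler_eq0 negb_or expf_neq0 ?prod_fj_neq0. Qed.

Lemma kummer_den0 : kummer_den 0 = 1.
Proof. by rewrite /kummer_den big1_seq // => j _; rewrite muln0 div0n. Qed.

Lemma kummer_fX i :
  kummer_f n u fj ^+ i = kummer_den i ^+ n * kummer_rad i.
Proof.
rewrite /kummer_f exprZn /kummer_rad -scalerAr; congr (_ *: _).
rewrite -!prodrXl -big_split; apply: eq_bigr => j _ /=.
by rewrite -!exprM -exprD -divn_eq.
Qed.

Lemma kummer_rad_power_free i t : t ^+ n %| kummer_rad i -> size t = 1%N.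
Proof.
rewrite /kummer_rad dvdpZr ?expf_neq0 //.
apply: (prod_power_free n_gt0 (e := fun j => ((j * i) %% n)%N)) => [j _|j||i' j].
- exact: ltn_pmod.
- by rewrite mem_index_iota; apply: sep_fj.
- exact: iota_uniq.
- by rewrite !mem_index_iota; apply: cop_fj.
Qed.

Lemma degp_mul (A B : {poly k}) : A != 0 -> B != 0 ->
  degp (A * B) = (degp A + degp B)%N.
Proof.
move=> A0 B0; rewrite (size_poly_mul A0 B0); move: A0 B0.
by rewrite !poly_neq0_size; case: (size A) (size B) => [|a] [|b] //=; rewrite addnS.
Qed.

Lemma degp_kummer_den i :
  degp (kummer_den i) = \sum_(1 <= j < n) (degp (fj j) * ((j * i) %/ n))%N.
Proof.
pose Pr (A : {poly k}) (d : nat) := A != 0 /\ degp A = d.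
suff [] : Pr (kummer_den i)
    (\sum_(1 <= j < n) (degp (fj j) * ((j * i) %/ n))%N)%N by [].
rewrite /kummer_den big_seq_cond [X in Pr _ X]big_seq_cond.
elim/big_ind2: _ => [|A a B b [A0 aE] [B0 bE]|j].
- by split; rewrite ?oner_eq0 // size_poly1.
- by split; rewrite ?mulf_neq0 // degp_mul // aE bE.
rewrite mem_index_iota andbT => /fj_neq0 f0.
by split; rewrite ?expf_neq0 // size_exp.
Qed.

Lemma degp_kummer_rad i :
  (degp (kummer_rad i) + n * degp (kummer_den i) = i * degp (kummer_f n u fj))%N.
Proof.
have := congr1 (fun A : {poly k} => degp A) (kummer_fX i).
rewrite size_exp degp_mul ?expf_neq0 ?kummer_den_neq0 ?kummer_rad_neq0 //.
rewrite size_exp => e; rewrite [RHS]mulnC e addnC; congr (_ + _)%N; exact: mulnC.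
Qed.

(** Since the radicand is f ^ i / kummer_den i ^ n, the number m_i is the order of
    vanishing at infinity that a coefficient needs in order to compensate the
    pole of y ^ i / kummer_den i there. *)
Lemma kummer_mE i :
  kummer_m n u fj i = Num.ceil ((degp (kummer_rad i))%:R / n%:R : rat).
Proof.
rewrite /kummer_m -degp_kummer_rad natrD mulrDl natrM mulrAC mulfV; last first.
  by rewrite pnatr_eq0 -lt0n.
have ceil_nat (d : nat) : Num.ceil (d%:R : rat) = d%:Z by exact: (intrKceil d%:Z).
rewrite mul1r ceilDrz ?natr_int // ceil_nat.
have -> : \sum_(1 <= j < n) (degp (fj j) * ((j * i) %/ n))%:Z
    = (degp (kummer_den i))%:Z.
  by rewrite degp_kummer_den (big_morph Posz PoszD (erefl _)).
by rewrite addrK.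
Qed.

Lemma kummer_m_bounds i : exists2 m : nat, kummer_m n u fj i = m%:Z &
  (degp (kummer_rad i) <= n * m < degp (kummer_rad i) + n)%N.
Proof.
have n0 : (0 : rat) < n%:R by rewrite ltr0n.
rewrite kummer_mE; set d := degp _; set c := Num.ceil _.
have /andP[lo hi] : (c - 1)%:~R < (d%:R / n%:R : rat) <= c%:~R := ceil_itv _.
have c_ge0 : 0 <= c by rewrite ceil_ge0 (lt_le_trans (ltrN10 _)) // divr_ge0 ?ler0n.
move: lo hi; rewrite ltr_pdivlMr // ler_pdivrMr //.
rewrite -[n%:R]/(n%:Z%:~R) -[d%:R]/(d%:Z%:~R) -!rmorphM /= ltr_int ler_int.
case: c c_ge0 => // m _ lo hi; exists m => //; lia.
Qed.

End KummerArithmetic.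

(** * Separating the eigenspaces of the Galois group *)

Lemma prim_root_orthogonal (k : fieldType) (n : nat) (z : k) (i j : 'I_n) :
    n%:R != 0 :> k -> n.-primitive_root z ->
  \sum_(t < n) n%:R^-1 * (z ^+ i)^-1 ^+ t * (z ^+ t) ^+ j = (i == j)%:R.
Proof.
move=> n0 prim_z; have n_gt0 := prim_order_gt0 prim_z.
have z0 m : z ^+ m != 0.
  apply/expf_neq0/eqP => z0; have /eqP := prim_expr_order prim_z.
  by rewrite z0 expr0n gtn_eqF // eq_sym oner_eq0.
pose x := (z ^+ i)^-1 * z ^+ j.
rewrite (eq_bigr (fun t : 'I_n => n%:R^-1 * x ^+ t)); last first.
  by move=> t _; rewrite -mulrA exprMn -!exprM [(t * j)%N]mulnC.
rewrite -mulr_sumr; case: eqVneq => [eq_ij | ne_ij].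
  rewrite /x eq_ij mulVf // (eq_bigr (fun=> 1)) => [|t _]; last by rewrite expr1n.
  by rewrite sumr_const card_ord mulVf.
have x1 : x - 1 != 0.
  rewrite subr_eq0; apply: contraNneq ne_ij => /(canRL (mulVKf (z0 i))).
  rewrite mulr1 => /eqP; rewrite (eq_prim_root_expr prim_z).
  by rewrite !modn_small // eq_sym => /eqP/ord_inj->.
have : (x - 1) * \sum_(t < n) x ^+ t = 0.
  rewrite -subrX1 exprMn exprVn -!exprM ![(_ * n)%N]mulnC !exprM.
  by rewrite (prim_expr_order prim_z) !expr1n invr1 mulr1 subrr.
by move/eqP; rewrite mulf_eq0 (negPf x1) => /eqP->; rewrite mulr0.
Qed.

(** A monic equation for g c descends along the injective map g. *)
Lemma fmorph_integral (R : comNzRingType) (F : fieldType) (L : nzRingType)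
    (phi : {rmorphism R -> F}) (g : {rmorphism F -> L}) (c : F) :
  integralOver (g \o phi) (g c) -> integralOver phi c.
Proof.
by case=> q mon_q; rewrite map_poly_comp fmorph_root; exists q.
Qed.

Section KummerField.
Variables (k : fieldType) (n : nat) (u : k) (fj : nat -> {poly k}).
Variables (K : fieldExtType (ratfun k)) (y : K).
Hypothesis hC : kummer_presentation n u fj y.
Variable zeta : k.
Hypothesis prim_zeta : n.-primitive_root zeta.

Let n_gt0 : (0 < n)%N. Proof. exact: prim_order_gt0 prim_zeta. Qed.

Local Notation den := (kummer_den n fj).
Local Notation rad := (kummer_rad n u fj).

Definition kummer_elt (i : nat) : K := (tofrac (den i))^-1 *: y ^+ i.
Local Notation z := kummer_elt.

Let tden_neq0 i : tofrac (den i) != 0.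
Proof. by rewrite tofrac_eq0 (kummer_den_neq0 (kp_sep hC)). Qed.

Let y_expX i : y ^+ i ^+ n = (tofrac (kummer_f n u fj ^+ i))%:A.
Proof. by rewrite exprAC (kp_root hC) exprZn expr1n tofracXn. Qed.

Lemma kummer_elt_exp i : z i ^+ n = (tofrac (rad i))%:A.
Proof.
rewrite /z exprZn y_expX scalerA kummer_fX tofracM tofracXn exprVn.
by rewrite (mulKf (expf_neq0 n (tden_neq0 i))).
Qed.

Lemma kummer_elt0 : z 0 = 1.
Proof. by rewrite /z kummer_den0 tofrac1 invr1 scale1r expr0. Qed.

Let q : {poly ratfun k} := 'X^n - (tofrac (kummer_f n u fj))%:P.

Let degp_q : degp q = n.
Proof. by rewrite /q size_XnsubC. Qed.

Let root_q (w : K) : w ^+ n = (tofrac (kummer_f n u fj))%:A ->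
  root (map_poly (in_alg K) q) w.
Proof.
move=> wn; rewrite /q rmorphB /= map_polyXn map_polyC /root !hornerE /=.
by rewrite wn subrr.
Qed.

Lemma kummer_elt_free (c : 'I_n -> ratfun k) :
  \sum_i c i *: z i = 0 -> forall i, c i = 0.
Proof.
move=> c0 i; pose c' (i : 'I_n) := c i / tofrac (den i).
have c'0 : \sum_i c' i *: y ^+ i = 0.
  by rewrite -[RHS]c0; apply: eq_bigr => j _; rewrite /z scalerA.
have /eqP := gen_free (kp_irr hC) (root_q (kp_root hC)) degp_q c'0 i.
by rewrite mulf_eq0 invr_eq0 (negPf (tden_neq0 i)) orbF => /eqP.
Qed.

Lemma kummer_elt_span (w : K) : exists c : 'I_n -> ratfun k, w = \sum_i c i *: z i.
Proof.
have [c ->] := gen_span (kp_irr hC) (root_q (kp_root hC)) (kp_gen hC) degp_q w.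
exists (fun i : 'I_n => c i * tofrac (den i)); apply: eq_bigr => i _.
by rewrite /z scalerA (mulfK (tden_neq0 i)).
Qed.

(** If m_i = 0 then z i is a function without poles: its n-th power is a constant
    polynomial, so z i is algebraic over k, hence a constant. That contradicts
    the independence of z i and z 0 = 1 over k(x). *)
Lemma kummer_m_gt0 (i : nat) : constants_trivial K -> (0 < i < n)%N ->
  0 < kummer_m n u fj i.
Proof.
move=> hconst /andP[i_gt0 lt_in].
have [m mE bounds] := kummer_m_bounds n_gt0 (kp_unit hC) (kp_sep hC) i.
case: m mE bounds => [|m] mE bounds; last by rewrite mE.
have rad_const : (size (rad i) <= 1)%N by move: bounds; lia.
have zn := kummer_elt_exp i; rewrite (size1_polyC rad_const) in zn.
set c := (rad i)`_0 in zn.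
have alg_z : algebraicOver (const_fun K) (z i).
  exists ('X^n - c%:P); first by rewrite monic_neq0 // monicXnsubC.
  rewrite -[const_fun K]/(in_alg K \o @FracField.tofrac _ \o polyC).
  rewrite rmorphB /= map_polyXn map_polyC /root !hornerE /= zn.
  by rewrite subrr.
have [c' zc'] := hconst _ alg_z.
pose l (j : 'I_n) : ratfun k := if val j == i then 1 else
  if val j == 0%N then - tofrac c'%:P else 0.
have l0 : \sum_j l j *: z j = 0.
  rewrite (bigD1 (Ordinal lt_in)) // (bigD1 (Ordinal n_gt0)) /=; last first.
    by rewrite -val_eqE /= ltn_eqF.
  rewrite big1 => [|j /andP[]].
    rewrite /l /= eqxx scale1r (ltn_eqF i_gt0) addr0 zc' kummer_elt0.
    by rewrite scaleNr subrr.
  by rewrite -!val_eqE /l /= => /negPf-> /negPf->; rewrite scale0r.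
have /eqP := kummer_elt_free l0 (Ordinal lt_in).
by rewrite /l eqxx oner_eq0.
Qed.

Let rconst : {rmorphism k -> ratfun k} := (@FracField.tofrac _ \o polyC).

Section Integral.
Hypothesis nk0 : n%:R != 0 :> k.
Variables (R : comNzRingType) (phi : {rmorphism R -> ratfun k}).
Hypothesis phi_const : forall a : k, exists b, phi b = tofrac a%:P.

Local Notation int := (integralOver (in_alg K \o phi)).

Lemma integral_scale_const (a : k) w : int w -> int (rconst a *: w).
Proof.
move=> iw; have [b bE] := phi_const a; rewrite -mulr_algl -[rconst a]bE.
by apply: integral_mul iw; apply: (integral_id (in_alg K \o phi) b).
Qed.

Lemma integral_sum (I : Type) (r : seq I) (Pr : pred I) (F : I -> K) :
  (forall i, Pr i -> int (F i)) -> int (\sum_(i <- r | Pr i) F i).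
Proof.
by move=> iF; elim/big_ind: _ => //; [apply: integral0 | apply: integral_add].
Qed.

(** The left factor a ^ j is the action of the automorphism y |-> a y. *)
Lemma integral_conj (a : k) (c : 'I_n -> ratfun k) : a ^+ n = 1 ->
  int (\sum_j c j *: z j) -> int (\sum_(j < n) rconst (a ^+ j) *: (c j *: z j)).
Proof.
move=> an1 [P mon_P Pw].
have [s [sy sZ]] : exists s : {rmorphism K -> K},
    s y = rconst a *: y /\ forall c w, s (c *: w) = c *: s w.
  apply: (conjugation (kp_irr hC) (root_q (kp_root hC)) (kp_gen hC)).
  apply: root_q; rewrite exprZn (kp_root hC) -rmorphXn an1 rmorph1.
  by rewrite scale1r.
have -> : \sum_(j < n) rconst (a ^+ j) *: (c j *: z j) = s (\sum_j c j *: z j).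
  rewrite raddf_sum; apply: eq_bigr => j _ /=; rewrite /z !sZ (rmorphXn s) sy exprZn.
  by rewrite -(rmorphXn rconst) !scalerA; congr (_ *: _); rewrite [RHS]mulrC mulrA.
exists P => //; have := rmorph_root s Pw; rewrite -map_poly_comp.
rewrite (eq_map_poly (g := in_alg K \o phi)) // => b /=.
by rewrite sZ rmorph1.
Qed.

(** Averaging the conjugates of w against the i-th character of the group of n-th
    roots of unity isolates the summand c_i z_i, so that summand is integral as
    soon as w is. Its n-th power lies in k(x), where integrality can be read off. *)
Lemma integral_coef (c : 'I_n -> ratfun k) i :
  int (\sum_j c j *: z j) -> integralOver phi (c i ^+ n * tofrac (rad i)).
Proof.
move=> iw; apply: (fmorph_integral (g := in_alg K)).
suff icz : int (c i *: z i).
  suff : int ((c i *: z i) ^+ n) by rewrite exprZn kummer_elt_exp scalerA.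
  elim: {2}n => [|m IH]; first exact: integral1.
  by rewrite exprS; apply: integral_mul.
have averaging (v : 'I_n -> K) :
    v i = \sum_(t < n) rconst (n%:R^-1 * (zeta ^+ i)^-1 ^+ t) *:
      \sum_(j < n) rconst ((zeta ^+ t) ^+ j) *: v j.
  rewrite (eq_bigr (fun t : 'I_n => \sum_(j < n)
    rconst (n%:R^-1 * (zeta ^+ i)^-1 ^+ t * (zeta ^+ t) ^+ j) *: v j)); last first.
    move=> t _; rewrite scaler_sumr; apply: eq_bigr => j _.
    by rewrite scalerA -(rmorphM rconst).
  rewrite exchange_big (eq_bigr (fun j => rconst (i == j)%:R *: v j)); last first.
    move=> j _; rewrite -scaler_suml -(rmorph_sum rconst).
    by rewrite prim_root_orthogonal.
  rewrite (bigD1 i) //= big1 ?addr0 => [|j ji].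
    by rewrite eqxx tofrac1 scale1r.
  by rewrite eq_sym (negPf ji) polyC0 tofrac0 scale0r.
have /= -> := averaging (fun j => c j *: z j).
apply: integral_sum => t _; apply: integral_scale_const; apply: integral_conj => //.
by rewrite exprAC (prim_expr_order prim_zeta) expr1n.
Qed.

End Integral.
End KummerField.

(** * Regular functions on the two charts and coboundaries *)

Lemma integral_sub_range (R R' L : comNzRingType) (f : {rmorphism R -> L})
    (g : {rmorphism R' -> L}) w :
  (forall b, exists b', f b = g b') -> integralOver f w -> integralOver g w.
Proof.
move=> sub_fg [P mon_P Pw].
apply: (integral_root_monic (monic_map f mon_P) Pw).
apply/integral_poly => i; rewrite coef_map /=; have [b' ->] := sub_fg P`_i.
exact: integral_id.
Qed.

Lemma integral_expr_root (R L : comNzRingType) (f : {rmorphism R -> L}) w m :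
  (0 < m)%N -> integralOver f (w ^+ m) -> integralOver f w.
Proof.
move=> m_gt0 iwm; have root_w : root ('X^m - (w ^+ m)%:P) w.
  by rewrite /root !hornerE subrr.
apply: (integral_root_monic (monicXnsubC _ m_gt0) root_w); apply/integral_poly => i.
rewrite coefB coefXn coefC; apply: integral_sub; first exact: integral_nat.
by case: eqP => // _; apply: integral0.
Qed.

Lemma integral_exp (R L : comNzRingType) (f : {rmorphism R -> L}) w m :
  integralOver f w -> integralOver f (w ^+ m).
Proof.
move=> iw; elim: m => [|m IH]; first exact: integral1.
by rewrite exprS; apply: integral_mul.
Qed.

Section Charts.
Variable k : fieldType.

Definition chart0 : {rmorphism {poly k} -> ratfun k} := @FracField.tofrac _.
Definition chartoo : {rmorphism {poly k} -> ratfun k} :=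
  horner_eval (ratX k)^-1 \o map_poly (@FracField.tofrac _ \o polyC).
Definition chart0oo : {rmorphism {poly {poly k}} -> ratfun k} :=
  horner_eval (ratX k)^-1 \o map_poly (@FracField.tofrac _).

Lemma ratX_neq0 : ratX k != 0.
Proof. by rewrite tofrac_eq0 polyX_eq0. Qed.

Lemma chartooE P : chartoo P = \sum_(i < size P) tofrac (P`_i)%:P * (ratX k)^-1 ^+ i.
Proof. exact: horner_poly. Qed.

Lemma chart0ooE P : chart0oo P = \sum_(i < size P) tofrac P`_i * (ratX k)^-1 ^+ i.
Proof. exact: horner_poly. Qed.

Lemma chart0_sub P : exists P', chart0 P = chart0oo P'.
Proof. by exists P%:P; rewrite /chart0oo /= map_polyC /horner_eval hornerC. Qed.

Lemma chartoo_sub P : exists P', chartoo P = chart0oo P'.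
Proof. by exists (map_poly polyC P); rewrite /chart0oo /= -map_poly_comp. Qed.

Lemma chartoo_pole_free P : pole_free_oo (chartoo P).
Proof.
rewrite chartooE; apply: pole_free_oo_sum => i _.
apply: pole_free_ooM; first exact: pole_free_oo_const.
apply: pole_free_ooX; exists 1, 'X.
by rewrite polyX_eq0 tofrac1 div1r size_poly1 size_polyX.
Qed.

Lemma ratX_cancel (N l : nat) : (l <= N)%N ->
  (ratX k)^-1 ^+ l * ratX k ^+ N = ratX k ^+ (N - l).
Proof.
move=> le_lN; rewrite -{1}(subnKC le_lN) exprD exprVn.
exact: (mulKf (expf_neq0 l ratX_neq0)).
Qed.

Lemma chart0oo_den P : exists N P', chart0oo P * tofrac 'X ^+ N = tofrac P'.
Proof.
exists (size P), (\sum_(i < size P) P`_i * 'X^(size P - i)).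
rewrite chart0ooE mulr_suml rmorph_sum; apply: eq_bigr => i _ /=.
by rewrite -mulrA ratX_cancel ?(ltnW (ltn_ord i)) // tofracM tofracXn.
Qed.

(** On monomials: x ^ (- N) x ^ l is a power of 1 / x because l <= N. *)
Lemma chartoo_image (E : {poly k}) N : (degp E <= N)%N ->
  exists P, (ratX k)^-1 ^+ N * tofrac E = chartoo P.
Proof.
move=> le_EN; exists (\sum_(l < size E) E`_l *: 'X^(N - l)).
have -> : tofrac E = \sum_(l < size E) tofrac (E`_l)%:P * ratX k ^+ l.
  rewrite -[in LHS](coefK E) poly_def rmorph_sum; apply: eq_bigr => l _ /=.
  by rewrite -mul_polyC tofracM tofracXn.
rewrite mulr_sumr rmorph_sum; apply: eq_bigr => l _ /=.
have le_lN : (l <= N)%N.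
  by rewrite (leq_trans _ le_EN) // -ltnS (leq_trans (ltn_ord l)) // leqSpred.
rewrite /chartoo /= /horner_eval map_polyZ map_polyXn hornerZ hornerXn /=.
rewrite mulrCA; congr (_ * _).
have {1}-> : N = (N - l + l)%N by rewrite subnK.
rewrite exprD -mulrA.
by rewrite ratX_cancel // subnn expr0 mulr1.
Qed.

End Charts.

Section KummerCohomology.
Variables (k : fieldType) (n : nat) (u : k) (fj : nat -> {poly k}).
Variables (K : fieldExtType (ratfun k)) (y : K).
Hypothesis hC : kummer_presentation n u fj y.
Hypothesis nk0 : n%:R != 0 :> k.
Variable zeta : k.
Hypothesis prim_zeta : n.-primitive_root zeta.

Let n_gt0 : (0 < n)%N. Proof. exact: prim_order_gt0 prim_zeta. Qed.

Local Notation rad := (kummer_rad n u fj).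
Local Notation z := (kummer_elt n fj y).

Lemma regular0_regular0oo w : regular0 w -> regular0oo (K := K) w.
Proof.
have sub P : exists P', (in_alg K \o chart0 k) P = (in_alg K \o chart0oo k) P'.
  by have [P' PE] := chart0_sub P; exists P'; rewrite -[LHS]/(in_alg K (chart0 k P)) PE.
exact: (integral_sub_range sub).
Qed.

Lemma regularoo_regular0oo w : regularoo w -> regular0oo (K := K) w.
Proof.
have sub P : exists P', (in_alg K \o chartoo k) P = (in_alg K \o chart0oo k) P'.
  by have [P' PE] := chartoo_sub P; exists P';
    rewrite -[LHS]/(in_alg K (chartoo k P)) PE.
exact: (integral_sub_range sub).
Qed.

Lemma chart0_const a : exists b, chart0 k b = tofrac a%:P.
Proof. by exists a%:P. Qed.

Lemma chartoo_const a : exists b, chartoo k b = tofrac a%:P.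
Proof. by exists a%:P; rewrite /chartoo /= map_polyC /horner_eval hornerC. Qed.

Lemma chart0oo_const a : exists b, chart0oo k b = tofrac a%:P.
Proof. by have [b <-] := chartoo_const a; have [b' ->] := chartoo_sub b; exists b'. Qed.

Lemma kummer_power_free_coef h (N : nat) P (c : ratfun k) i :
  c ^+ n * tofrac (rad i) * tofrac h ^+ N = tofrac P ->
  exists P', c * tofrac h ^+ N = tofrac P'.
Proof.
apply: (power_free_denominator n_gt0).
  exact: kummer_rad_neq0 (kp_unit hC) (kp_sep hC) i.
exact: (kummer_rad_power_free n_gt0 (kp_unit hC) (kp_sep hC) (kp_coprime hC)).
Qed.

Lemma regular0_coef (c : 'I_n -> ratfun k) i :
  regular0 (\sum_j c j *: z j) -> exists P, c i = tofrac P.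
Proof.
move/(integral_coef hC prim_zeta nk0 (@chart0_const)) => /(_ i) ic.
have [|N [P PE]] := @integral_denominator _ _ (chart0 k) 1 _ _ ic.
  by move=> b; exists 0%N, b; rewrite expr0 mulr1.
have [P'] := kummer_power_free_coef PE.
by rewrite tofrac1 expr1n mulr1; exists P'.
Qed.

Lemma regular0oo_coef (c : 'I_n -> ratfun k) i :
  regular0oo (\sum_j c j *: z j) -> exists N P, c i * ratX k ^+ N = tofrac P.
Proof.
move/(integral_coef hC prim_zeta nk0 (@chart0oo_const)) => /(_ i) ic.
have [N [P PE]] := integral_denominator (@chart0oo_den k) ic.
by have [P' P'E] := kummer_power_free_coef PE; exists N, P'.
Qed.

Lemma regularoo_coef (c : 'I_n -> ratfun k) (i : 'I_n) m :
    (n * m < degp (rad i) + n)%N ->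
  regularoo (\sum_j c j *: z j) -> pole_free_oo (c i * tofrac 'X^m).
Proof.
move=> lt_m /(integral_coef hC prim_zeta nk0 (@chartoo_const)) => /(_ i) ic.
apply: pole_free_oo_root n_gt0 _ lt_m _.
  exact: kummer_rad_neq0 (kp_unit hC) (kp_sep hC) i.
exact: integral_pole_free_oo (@chartoo_pole_free k) ic.
Qed.

Lemma regular0_elt P i : regular0 (tofrac P *: z i).
Proof.
suff iz : integralOver (in_alg K \o chart0 k) (z i).
  rewrite -mulr_algl; apply: (integral_mul _ iz).
  exact: (integral_id (in_alg K \o chart0 k) P).
apply: (integral_expr_root n_gt0); rewrite (kummer_elt_exp hC).
exact: (integral_id (in_alg K \o chart0 k) (rad i)).
Qed.

Lemma regularoo_elt a i : (degp (rad i) <= n * a)%N ->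
  regularoo ((ratX k)^-1 ^+ a *: z i).
Proof.
move=> le_a; have [P PE] := chartoo_image le_a.
apply: (@integral_expr_root _ _ (in_alg K \o chartoo k) _ n n_gt0).
rewrite exprZn (kummer_elt_exp hC) scalerA -exprM mulnC PE.
exact: (integral_id (in_alg K \o chartoo k) P).
Qed.

Lemma coboundD w w' : H1_cobound (K := K) w -> H1_cobound w' -> H1_cobound (w + w').
Proof.
move=> [w0 [woo [r0 roo ->]]] [v0 [voo [s0 soo ->]]].
exists (w0 + v0), (woo + voo); split; last by rewrite opprD addrACA.
  exact: (@integral_add _ _ (in_alg K \o chart0 k)).
exact: (@integral_add _ _ (in_alg K \o chartoo k)).
Qed.

Lemma coboundZ a w : H1_cobound (K := K) w -> H1_cobound (const_fun K a * w).
Proof.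
move=> [w0 [woo [r0 roo ->]]].
exists (const_fun K a * w0), (const_fun K a * woo); split; last by rewrite mulrBr.
  apply: (@integral_mul _ _ (in_alg K \o chart0 k)) r0.
  exact: (integral_id (in_alg K \o chart0 k) a%:P).
apply: (@integral_mul _ _ (in_alg K \o chartoo k)) roo.
have [b bE] := chartoo_const a; rewrite /const_fun -bE.
exact: (integral_id (in_alg K \o chartoo k) b).
Qed.

Lemma regular0oo_lin a w w' : regular0oo (K := K) w -> regular0oo w' ->
  regular0oo (const_fun K a * w + w').
Proof.
move=> rw rw'; apply: (@integral_add _ _ (in_alg K \o chart0oo k)) rw'.
apply: (@integral_mul _ _ (in_alg K \o chart0oo k)) rw.
have [b bE] := chart0oo_const a; rewrite /const_fun -bE.
exact: (integral_id (in_alg K \o chart0oo k) b).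
Qed.

Lemma regular0_cobound w : regular0 (K := K) w -> H1_cobound w.
Proof.
move=> rw; exists w, 0; rewrite subr0; split=> //.
exact: (integral0 (in_alg K \o chartoo k)).
Qed.

Lemma regularoo_cobound w : regularoo (K := K) w -> H1_cobound w.
Proof.
move=> rw; exists 0, (- w); rewrite opprK add0r; split=> //.
  exact: (integral0 (in_alg K \o chart0 k)).
exact: (@integral_opp _ _ (in_alg K \o chartoo k)).
Qed.

Lemma cobound_regular0oo w : H1_cobound (K := K) w -> regular0oo w.
Proof.
move=> [w0 [woo [/regular0_regular0oo r0 /regularoo_regular0oo roo ->]]].
exact: (@integral_sub _ _ (in_alg K \o chart0oo k)).
Qed.

(** The splitting of a coboundary into its two regular parts is compatible with
    the decomposition into eigenspaces, so it can be read coefficientwise. *)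
Lemma cobound_coef (c : 'I_n -> ratfun k) (i : 'I_n) m :
    (n * m < degp (rad i) + n)%N -> H1_cobound (\sum_j c j *: z j) ->
  exists P R, c i = tofrac P + R /\ pole_free_oo (R * tofrac 'X^m).
Proof.
move=> lt_m [w0 [woo [r0 roo]]].
have [c0 c0E] := kummer_elt_span hC prim_zeta w0.
have [coo cooE] := kummer_elt_span hC prim_zeta woo.
rewrite c0E cooE in r0 roo *; rewrite -sumrB => eq_c.
have : \sum_j (c j - (c0 j - coo j)) *: z j = 0.
  under eq_bigr do rewrite scalerBl; rewrite sumrB eq_c -sumrB big1 // => j _.
  by rewrite scalerBl subrr.
move/(kummer_elt_free hC prim_zeta)/(_ i)/eqP; rewrite subr_eq0 => /eqP ->.
have [P ->] := regular0_coef i r0; exists P, (- coo i); split=> //.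
have [A [B [B0 E le_AB]]] := regularoo_coef lt_m roo.
exists (- A), B; split=> //; last by rewrite size_polyN.
by rewrite mulNr E tofracN mulNr.
Qed.

End KummerCohomology.

(** * Frobenius on the normalized powers *)

Section Frobenius.
Variables (k : fieldType) (p : nat) (K : fieldExtType (ratfun k)).
Hypothesis hp : p \in [pchar k].

Lemma pchar_fieldext : p \in [pchar K].
Proof. exact: (rmorph_pchar (in_alg K \o chart0 k \o polyC) hp). Qed.

Lemma frobD (v w : K) : (v + w) ^+ p = v ^+ p + w ^+ p.
Proof. exact: (pFrobenius_autD_comm pchar_fieldext (mulrC v w)). Qed.

Lemma frob_sum (I : finType) (F : I -> K) :
  (\sum_i F i) ^+ p = \sum_i F i ^+ p.
Proof. exact: (rmorph_sum (pFrobenius_aut pchar_fieldext)). Qed.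

Lemma cobound_frob (w : K) : H1_cobound w -> H1_cobound (w ^+ p).
Proof.
move=> [w0 [woo [r0 roo ->]]]; exists (w0 ^+ p), (woo ^+ p); split.
- exact: (@integral_exp _ _ (in_alg K \o chart0 k)).
- exact: (@integral_exp _ _ (in_alg K \o chartoo k)).
- exact: (rmorphB (pFrobenius_aut pchar_fieldext) w0 woo).
Qed.

End Frobenius.

Section KummerFrobenius.
Variables (k : fieldType) (p n : nat) (u : k) (fj : nat -> {poly k}).
Variables (K : fieldExtType (ratfun k)) (y : K).
Hypothesis hC : kummer_presentation n u fj y.
Variable zeta : k.
Hypothesis prim_zeta : n.-primitive_root zeta.

Let n_gt0 : (0 < n)%N. Proof. exact: prim_order_gt0 prim_zeta. Qed.

Local Notation den := (kummer_den n fj).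
Local Notation z := (kummer_elt n fj y).
Local Notation Q := (kummer_Q p n u fj).

Lemma kummer_Q_tofrac i : tofrac (Q i) =
  tofrac (kummer_f n u fj) ^+ ((p * i) %/ n)
    * (tofrac (den ((p * i) %% n)) / tofrac (den i) ^+ p).
Proof.
have fj0 j : (1 <= j < n)%N -> fj j != 0.
  by move/(kp_sep hC)/separable_poly_neq0.
rewrite (kummer_QE _ _ _ n_gt0 fj0) /kummer_Q_frac; congr (_ * _).
rewrite -[RHS]invf_div; congr (_^-1).
rewrite /kummer_den !rmorph_prod -prodrXl -prodf_div.
rewrite big_nat_cond [RHS]big_nat_cond; apply: eq_bigr => j.
rewrite andbT => /fj0; rewrite -tofrac_eq0 => tfj0.
by rewrite (expfzDr _ _ tfj0) -exprnN !rmorphXn /= -exprM mulnC.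
Qed.

Lemma kummer_Q_neq0 i : Q i != 0.
Proof.
have f0 : kummer_f n u fj != 0.
  by rewrite scaler_eq0 negb_or (kp_unit hC) (prod_fj_neq0 (kp_sep hC)).
have den0 j : tofrac (den j) != 0.
  by rewrite tofrac_eq0 (kummer_den_neq0 (kp_sep hC)).
rewrite -tofrac_eq0 kummer_Q_tofrac.
apply: mulf_neq0; first by rewrite expf_neq0 // tofrac_eq0.
by apply: mulf_neq0; rewrite ?invr_eq0 ?expf_neq0.
Qed.

(** Write y ^ (p i) = f ^ floor(p i / n) y ^ (p i mod n); Q_i collects f to this
    power and the change of normalizing denominator. *)
Lemma kummer_elt_frob i : z i ^+ p = tofrac (Q i) *: z ((p * i) %% n).
Proof.
rewrite /kummer_elt exprZn scalerA kummer_Q_tofrac.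
have := kummer_den_neq0 (kp_sep hC) ((p * i) %% n)%N; rewrite -tofrac_eq0 => d0.
have aux (F : fieldType) (a b c : F) m : b != 0 -> a * (b / c ^+ m) / b = c^-1 ^+ m * a.
  by move=> b0; rewrite mulrA mulrAC mulfK // exprVn mulrC.
rewrite (aux _ _ _ _ _ d0) -exprM mulnC -scalerA; congr (_ *: _).
rewrite {1}(divn_eq (p * i) n) exprD mulnC exprM (kp_root hC) exprZn expr1n.
by rewrite mulr_algl.
Qed.

End KummerFrobenius.

(** * A basis of the first cohomology group, and Frobenius on it *)

Lemma laurent_expand (k : fieldType) (c : ratfun k) N P :
    c * ratX k ^+ N = tofrac P ->
  c = \sum_(l < size P) tofrac (P`_l)%:P * (ratX k ^+ l * (ratX k)^-1 ^+ N).
Proof.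
move=> cP; apply: (mulIf (expf_neq0 N (ratX_neq0 k))); rewrite cP.
rewrite -[in LHS](coefK P) poly_def rmorph_sum mulr_suml; apply: eq_bigr => l _ /=.
rewrite -mul_polyC tofracM tofracXn -[in RHS]mulrA -[in RHS]mulrA.
by rewrite ratX_cancel // subnn expr0 mulr1.
Qed.

Section KummerCocycles.
Variables (k : fieldType) (n : nat) (u : k) (fj : nat -> {poly k}).
Variables (K : fieldExtType (ratfun k)) (y : K).
Hypothesis hC : kummer_presentation n u fj y.
Variable zeta : k.
Hypothesis prim_zeta : n.-primitive_root zeta.

Let n_gt0 : (0 < n)%N. Proof. exact: prim_order_gt0 prim_zeta. Qed.

Local Notation rad := (kummer_rad n u fj).
Local Notation z := (kummer_elt n fj y).

(** The numbers m_i are nonnegative; this is their natural number version. *)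
Definition kummer_mn (i : nat) : nat := `|kummer_m n u fj i|%N.
Local Notation m := kummer_mn.

Lemma kummer_mnE i : kummer_m n u fj i = (m i)%:Z.
Proof.
by have [d mE _] := kummer_m_bounds n_gt0 (kp_unit hC) (kp_sep hC) i; rewrite /m mE.
Qed.

Lemma kummer_mn_bounds i : (degp (rad i) <= n * m i < degp (rad i) + n)%N.
Proof.
by have [d mE] := kummer_m_bounds n_gt0 (kp_unit hC) (kp_sep hC) i; rewrite /m mE.
Qed.

Lemma kummer_mn0 : m 0 = 0%N.
Proof.
have := kummer_mn_bounds 0; rewrite /kummer_rad expr0 scale1r big1_seq => [|j _].
  by rewrite size_poly1 /= add0n; case: (m 0) => // d; rewrite ltnNge mulnS leq_addr.
by rewrite muln0 mod0n.
Qed.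

Lemma kummer_mn_gt0 i : constants_trivial K -> (0 < i < n)%N -> (0 < m i)%N.
Proof.
move=> hconst /(kummer_m_gt0 hC prim_zeta hconst).
by rewrite kummer_mnE.
Qed.

Hypothesis nk0 : n%:R != 0 :> k.

Local Notation index := {i : 'I_n & 'I_(m i).-1}.

(** The index (i, a) stands for the cocycle x ^ (- (a + 1)) z_i, so that the
    exponents run from 1 to m_i - 1. *)
Definition cocycle (x : index) : K := (ratX k)^-1 ^+ (tagged x).+1 *: z (tag x).

Definition principal_part (c : index -> k) (i : 'I_n) : ratfun k :=
  \sum_(a < (m i).-1) tofrac (c (Tagged _ a))%:P * (ratX k)^-1 ^+ a.+1.

Definition cocycle_sum (c : index -> k) : K :=
  \sum_x const_fun K (c x) * cocycle x.

Lemma cocycle_sumE c : cocycle_sum c = \sum_i principal_part c i *: z i.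
Proof.
under [RHS]eq_bigr do rewrite scaler_suml.
rewrite sig_big_dep /=; apply: eq_bigr => -[i a] _ /=.
by rewrite /const_fun /cocycle /= mulr_algl scalerA.
Qed.

Lemma cocycle_sumD c c' :
  cocycle_sum (fun x => c x + c' x) = cocycle_sum c + cocycle_sum c'.
Proof.
rewrite /cocycle_sum -big_split; apply: eq_bigr => x _ /=.
by rewrite /const_fun polyCD tofracD scalerDl mulrDl.
Qed.

(** The cocycles whose class is a combination of the basis classes. *)
Let normalizable (w : K) := exists c, H1_cobound (w - cocycle_sum c).

Let cobound0 : H1_cobound (0 : K).
Proof.
by have := regular0_cobound (regular0_elt hC prim_zeta 0 0); rewrite tofrac0 scale0r.
Qed.

Let cocycle_sum0 : cocycle_sum (fun=> 0) = 0.
Proof.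
by apply: big1 => x _; rewrite /const_fun polyC0 tofrac0 scale0r mul0r.
Qed.

Let cobound_normal w : H1_cobound w -> normalizable w.
Proof. by move=> cw; exists (fun=> 0); rewrite cocycle_sum0 subr0. Qed.

Let normalD w w' : normalizable w -> normalizable w' -> normalizable (w + w').
Proof.
move=> [c cw] [c' cw']; exists (fun x => c x + c' x).
by rewrite cocycle_sumD opprD addrACA; apply: coboundD.
Qed.

Let normal_sum (I : finType) (F : I -> K) :
  (forall i, normalizable (F i)) -> normalizable (\sum_i F i).
Proof.
by move=> gF; elim/big_ind: _ => //; apply: cobound_normal.
Qed.

(** A monomial x ^ e z_i is regular over the affine line when e >= 0, regular at
    infinity when e <= - m_i, and a basis cocycle in between. *)
Let normal_monomial (a : k) l N (i : 'I_n) :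
  normalizable ((tofrac a%:P * (ratX k ^+ l * (ratX k)^-1 ^+ N)) *: z i).
Proof.
rewrite -scalerA -mulr_algl -/(const_fun K a).
have [le_Nl | lt_lN] := leqP N l.
  apply/cobound_normal/coboundZ/regular0_cobound.
  rewrite mulrC ratX_cancel // /ratX -tofracXn.
  exact: (regular0_elt hC prim_zeta).
have -> : ratX k ^+ l * (ratX k)^-1 ^+ N = (ratX k)^-1 ^+ (N - l.+1).+1.
  by rewrite subnSK // [RHS](expr_sub_inv (invr_neq0 (ratX_neq0 k)) (leq_subr l N))
    invrK subKn ?(ltnW lt_lN) // mulrC.
have [le_m | lt_m] := leqP (m i) (N - l.+1).+1.
  apply/cobound_normal/coboundZ/regularoo_cobound/(regularoo_elt hC prim_zeta).
  have /andP[le_i _] := kummer_mn_bounds i.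
  by rewrite (leq_trans le_i) // leq_mul2l le_m orbT.
have lt_m' : (N - l.+1 < (m i).-1)%N by move: lt_m; case: (m i).
pose x0 : index := Tagged (fun i : 'I_n => 'I_(m i).-1) (Ordinal lt_m').
exists (fun x => if x == x0 then a else 0).
rewrite /cocycle_sum (bigD1 x0) //= eqxx big1 ?addr0 => [|x /negPf->].
  by rewrite subrr.
by rewrite /const_fun polyC0 tofrac0 scale0r mul0r.
Qed.

Lemma cocycle_span w : regular0oo w -> exists c, H1_cobound (w - cocycle_sum c).
Proof.
have [c ->] := kummer_elt_span hC prim_zeta w => rw.
apply: normal_sum => i; have [N [P PE]] := regular0oo_coef hC nk0 prim_zeta i rw.
rewrite (laurent_expand PE) scaler_suml; apply: normal_sum => l.
exact: normal_monomial.
Qed.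

(** The exponents 1, ..., m_i - 1 are those in the window of the leading term
    argument with Q = 1. *)
Lemma cocycle_free c : H1_cobound (cocycle_sum c) -> forall x, c x = 0.
Proof.
rewrite cocycle_sumE => cob [i a]; have /andP[_ lt_m] := kummer_mn_bounds i.
have [P [R [eqPR poleR]]] := cobound_coef hC nk0 prim_zeta lt_m cob.
apply: (principal_part_eq0 (Q := 1) (P := P) (s := 1)
          (l := fun a => c (Tagged (fun i : 'I_n => 'I_(m i).-1) a)) _ _ poleR).
- exact: oner_neq0.
- by [].
- move=> b _; rewrite size_poly1 mul1n /= add0n.
  by rewrite -ltn_predRL ltn_ord.
rewrite tofrac1 mul1r -eqPR /principal_part; apply: eq_bigr => b _.
by rewrite mul1n.
Qed.

Variable p : nat.
Hypothesis hp : p \in [pchar k].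

Let p_prime : prime p. Proof. exact: pcharf_prime hp. Qed.
Let hn : ~~ (p %| n)%N. Proof. by rewrite (dvdn_pcharf hp). Qed.

Local Notation Q := (kummer_Q p n u fj).

Definition mul_p (i : 'I_n) : 'I_n := Ordinal (ltn_pmod (p * i) n_gt0).

(** Different eigenspaces are sent to different eigenspaces because p is prime
    to n. *)
Lemma mul_p_inj : injective mul_p.
Proof.
suff le_inj i j : mul_p i = mul_p j -> (j <= i)%N -> i = j.
  move=> i j eq_ij; have [le_ji | /ltnW le_ij] := leqP j i; first exact: le_inj.
  exact/esym/le_inj.
move=> /(congr1 val) /= /eqP eq_ij le_ji.
have cop : coprime n p by rewrite coprime_sym prime_coprime.
move: eq_ij; rewrite eqn_mod_dvd ?leq_mul2l ?le_ji ?orbT // -mulnBr Gauss_dvdr //.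
have [d0 _ | d_gt0 dvd_n] := posnP (i - j)%N.
  by apply/ord_inj/eqP; rewrite eqn_leq le_ji andbT -subn_eq0 d0.
have := dvdn_leq d_gt0 dvd_n.
by rewrite leqNgt (leq_ltn_trans (leq_subr j i) (ltn_ord i)).
Qed.

Lemma cocycle_sum_frob c : cocycle_sum c ^+ p =
  \sum_(i < n) (tofrac (Q i) * principal_part c i ^+ p) *: z (mul_p i).
Proof.
rewrite cocycle_sumE (frob_sum hp); apply: eq_bigr => i _.
by rewrite exprZn (kummer_elt_frob p hC prim_zeta) scalerA mulrC.
Qed.

(** The indices at which the leading exponent deg Q_i - p (a + 1) of the image
    under Frobenius is one of the exponents -1, ..., - (m - 1) of the basis of the
    target eigenspace. *)
Definition in_window (x : index) : bool :=
  (degp (Q (tag x)) < p * (tagged x).+1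
                    < degp (Q (tag x)) + m ((p * tag x) %% n))%N.

Lemma principal_part_frob c i : principal_part c i ^+ p =
  \sum_(a < (m i).-1) tofrac (c (Tagged _ a) ^+ p)%:P * (ratX k)^-1 ^+ (p * a.+1).
Proof.
have hpF : p \in [pchar (ratfun k)].
  exact: (rmorph_pchar (chart0 k \o polyC) hp).
rewrite -(pFrobenius_autE hpF) rmorph_sum; apply: eq_bigr => a _ /=.
by rewrite pFrobenius_autE exprMn -tofracXn -polyC_exp -exprM mulnC.
Qed.

(** The hypothesis on c says that it is supported on indices in the window. The
    coefficient of the image in the eigenspace p i mod n comes from the
    eigenspace i alone, so the leading term argument applies to each i. *)
Lemma frob_injective c : H1_cobound (cocycle_sum c ^+ p) ->
  (forall x, ~~ in_window x -> c x = 0) -> forall x, c x = 0.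
Proof.
rewrite cocycle_sum_frob => cob c_supp [i a].
(* The image regrouped by target eigenspace. *)
pose l (j : 'I_n) := let i := invF mul_p_inj j in
  tofrac (Q i) * principal_part c i ^+ p.
have {cob}cob : H1_cobound (\sum_j l j *: z j).
  rewrite (reindex_inj mul_p_inj) /=; move: cob; congr H1_cobound.
  by apply: eq_bigr => j _; rewrite /l invF_f.
have /andP[_ lt_m] := kummer_mn_bounds (mul_p i).
have [P [R [eqPR poleR]]] := cobound_coef hC nk0 prim_zeta lt_m cob.
have cp0 : c (Tagged _ a) ^+ p = 0.
  apply: (principal_part_eq0 (Q := Q i) (P := P) (s := p)
    (l := fun a => c (Tagged (fun i : 'I_n => 'I_(m i).-1) a) ^+ p) _ _ poleR).
  - exact: (kummer_Q_neq0 p hC prim_zeta).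
  - exact: prime_gt0.
  - move=> b; rewrite expf_eq0 prime_gt0 //=; apply: contraR => notJ.
    by apply/eqP/c_supp; rewrite /in_window.
  - by rewrite -principal_part_frob -eqPR /l invF_f.
by move/eqP: cp0; rewrite expf_eq0 => /andP[_ /eqP].
Qed.

End KummerCocycles.

(** * The bound *)

Lemma count_window mu v q :
  (\sum_(a < mu) ~~ (v <= a < q) = mu - (minn q mu - v))%N.
Proof.
elim: mu => [|mu IH]; first by rewrite big_ord0.
rewrite big_ord_recr /= IH; lia.
Qed.

(** With mu = m - 1 exponents in total, those outside the window v < a <= q number
    at most mu, and at most the larger of mu - q + v and v. *)
Lemma window_bound (m v q : nat) : (0 < m)%N ->
  (m.-1 - (minn q m.-1 - v))%:Z
    <= -1 + Num.min m%:Z (Num.max (m%:Z - q%:Z + v%:Z) (1 + v%:Z)).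
Proof. by move=> m_gt0; rewrite addrC lerBrDr le_min le_max; lia. Qed.

(** The number of basis cocycles in the i-th eigenspace that are outside the
    window; it bounds the dimension of the kernel of Frobenius there. *)
Definition frob_ker_bound (k : fieldType) (p n : nat) (u : k) (fj : nat -> {poly k})
    (i : nat) : nat :=
  \sum_(a < (kummer_mn n u fj i).-1)
     ~~ (degp (kummer_Q p n u fj i) < p * a.+1
          < degp (kummer_Q p n u fj i) + kummer_mn n u fj ((p * i) %% n))%N.

Theorem corollary2 (k : fieldType) (p n : nat)
    (hp : p \in [pchar k]) (hn : ~~ (p %| n)%N)
    (hroots : exists z : k, n.-primitive_root z)
    (K : fieldExtType (ratfun k)) (y : K)
    (hconst : constants_trivial K)
    (u : k) (fj : nat -> {poly k})
    (hC : kummer_presentation n u fj y) :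
  exists2 a : nat, a_number_is K p a &
    a%:Z <= 1 - n%:Z +
      \sum_(1 <= i < n)
        Num.min (kummer_m n u fj i)
          (Num.max (kummer_m n u fj i - kummer_q p n u fj i
                      + (kummer_v p n u fj i)%:Z)
                   (1 + (kummer_v p n u fj i)%:Z)).
Proof.
have [zeta prim_zeta] := hroots; have n_gt0 := prim_order_gt0 prim_zeta.
have nk0 : n%:R != 0 :> k by rewrite -(dvdn_pcharf hp).
have p_prime : prime p := pcharf_prime hp.
have p_gt0 := prime_gt0 p_prime.
have [|b v w [rv cv] [rw cw] | w cw | v w | w [rw _] | c | c [_ cc] | a ha le_a] :=
  @quot_dim_le k K (frob_ker p) (@H1_cobound k K) _
    (cocycle (n := n) (u := u) (fj := fj) y)
    [pred x | ~~ in_window p x].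
- split; first exact: (integral0 (in_alg K \o chart0oo k)).
  rewrite expr0n gtn_eqF //; apply: regular0_cobound.
  exact: (integral0 (in_alg K \o chart0 k)).
- split; first exact: regular0oo_lin.
  rewrite (frobD hp) exprMn; apply: coboundD cw.
  have -> : const_fun K b ^+ p = const_fun K (b ^+ p).
    by rewrite /const_fun exprZn expr1n polyC_exp tofracXn.
  exact: coboundZ.
- by split; [apply: cobound_regular0oo | apply: (cobound_frob hp)].
- exact: coboundD.
- exact: (cocycle_span hC prim_zeta nk0 rw).
- exact: (cocycle_free hC prim_zeta nk0).
- move=> c0; apply: (frob_injective hC prim_zeta nk0 hp cc) => x nJ.
  exact: c0.
exists a => //.
apply: (@le_trans _ _ (\sum_(1 <= i < n) (frob_ker_bound p n u fj i)%:Z)).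
  rewrite -(big_morph Posz PoszD (erefl _)) lez_nat (leq_trans le_a) //.
  rewrite -sum1_card big_mkcond /=.
  have bound0 : frob_ker_bound p n u fj 0 = 0%N.
    by rewrite /frob_ker_bound (kummer_mn0 hC prim_zeta) big_ord0.
  have -> : (\sum_(1 <= i < n) frob_ker_bound p n u fj i
      = \sum_(0 <= i < n) frob_ker_bound p n u fj i)%N.
    by rewrite [RHS]big_ltn // bound0.
  rewrite big_mkord sig_big_dep /=.
  by apply/eq_leq/eq_bigr => -[i b] _; rewrite inE /in_window /=; case: (~~ _).
have -> : 1 - n%:Z = \sum_(1 <= i < n) (-1 : int).
  by rewrite sumr_const_nat -mulr_natr; lia.
rewrite -big_split /= big_nat [leRHS]big_nat; apply: ler_sum => i lt_in.
rewrite /kummer_q /kummer_v !(kummer_mnE hC prim_zeta) /frob_ker_bound.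
set d := degp _; set m := kummer_mn n u fj i; set m' := kummer_mn _ _ _ (_ %% _).
have m_gt0 : (0 < m)%N by apply: (kummer_mn_gt0 hC prim_zeta hconst).
have m'_gt0 : (0 < m')%N.
  apply: (kummer_mn_gt0 hC prim_zeta hconst); rewrite ltn_pmod // andbT lt0n.
  have cop : coprime n p by rewrite coprime_sym prime_coprime.
  rewrite -/(dvdn n (p * i)) Gauss_dvdr //; have /andP[i_gt0 ltin] := lt_in.
  by apply/negP => /(dvdn_leq i_gt0); rewrite leqNgt ltin.
have -> : d%:Z + m'%:Z - 1 = (d + m').-1%:Z by lia.
rewrite divz_nat; set q := ((d + m').-1 %/ p)%N; set v := (d %/ p)%N.
rewrite (eq_bigr (fun a : 'I_m.-1 => ~~ (v <= a < q)%N : nat)) => [|b _].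
  by rewrite count_window; apply: window_bound.
congr (nat_of_bool (~~ (_ && _))).
  by rewrite -[(v <= b)%N]ltnS ltn_divLR // mulnC.
by rewrite [RHS]leq_divRL // -[RHS]ltnS prednK ?addn_gt0 ?m'_gt0 ?orbT // mulnC.
Qed.
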